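(* Let $V$ be any vertex algebra over $\mathbb{C}$. Then every derivation of the vertex algebra $\mathbb{C}((z))\otimes V$, restricted to $V=1\otimes V$, is a pseudoderivation of $V$. On the other hand, the $\mathbb{C}((z))$-linear extension to $\mathbb{C}((z))\otimes V$ of any pseudoderivation of $V$ is a derivation of the vertex algebra $\mathbb{C}((z))\otimes V$. Furthermore, $$\mathrm{Der}_{\mathbb{C}((z))}(\mathbb{C}((z))\otimes V)=\mathrm{PDer}(V),$$ where the two sides are identified via restriction to $V$ and $\mathbb{C}((z))$-linear extension.
   Context: Vertex algebras are over $\mathbb{C}$, with vacuum vector $\mathbf{1}$ and vertex operator map $Y\colon V\to \mathrm{Hom}(V,V((x)))$, $Y(v,x)=\sum_{n\in\mathbb{Z}}v_n x^{-n-1}$. The canonical operator $\mathcal{D}$ on $V$ is $\mathcal{D}(v)=v_{-2}\mathbf{1}$; it acts on $\mathbb{C}((z))\otimes V$ as $1\otimes\mathcal{D}$. A derivation of a vertex algebra $V$ is a $\mathbb{C}$-linear endomorphism $d$ of $V$ such that $dY(u,x)v=Y(u,x)dv+Y(du,x)v$ for $u,v\in V$. Conventions: $\otimes=\otimes_{\mathbb{C}}$ (the algebraic tensor product), and $z,x$ are formal variables. For $f(z)\in\mathbb{C}((z))$, $f(z+x)=e^{x\,d/dz}f(z)\in\mathbb{C}((z))[[x]]$. If $a(z)u=\sum_i f_i(z)\otimes u_i$ (a finite sum), then $a(z+x)u=\sum_i f_i(z+x)\otimes u_i\in\mathbb{C}((z))[[x]]\otimes V$. The map $Y(\cdot,x)$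 is extended $\mathbb{C}((z))[[x]]$-linearly to $\mathbb{C}((z))[[x]]\otimes V$, and the operators $Y(u,x)$ are extended $\mathbb{C}((z))$-linearly to act on $\mathbb{C}((z))\otimes V$. The map $\frac{d}{dz}a(z)$ is $v\mapsto (\frac{d}{dz}\otimes 1)(a(z)v)$. A pseudoderivation of $V$ is a $\mathbb{C}$-linear map $a(z)\colon V\to\mathbb{C}((z))\otimes V$ such that $$[\mathcal{D},a(z)]=-\frac{d}{dz}a(z),\qquad [a(z),Y(u,x)]=Y(a(z+x)u,x)\quad\text{for } u\in V,$$ as identities of maps on $V$ (with $a(z)$ applied coefficientwise in $x$). $\mathrm{PDer}(V)$ is the space of all pseudoderivations of $V$. There is a natural identification $\mathrm{Hom}_{\mathbb{C}}(V,\mathbb{C}((z))\otimes V)\simeq\mathrm{End}_{\mathbb{C}((z))}(\mathbb{C}((z))\otimes V)$ given by $\mathbb{C}((z))$-linear extension, with inverse given by restriction to $1\otimes V$. The vertex algebra $\mathbb{C}((z))\otimes V$ over $\mathbb{C}$ is the tensor product of $V$ with Borcherds' vertex algebra $\mathbb{C}((z))$ (vacuum $1$, $Y(f(z),x)g(z)=f(z+x)g(z)$). Its vacuum is $1\otimes\mathbf{1}$ and its vertex operator map is $$\widehat{Y}(f(z)\otimes u,x)(g(z)\otimes v)=f(z+x)g(z)\otimes Y(u,x)v,\qquad f,g\in\mathbb{C}((z)),\ u,v\in V.$$ $\mathrm{Der}_{\mathbb{C}((z))}(\mathbb{C}((z))\otimes V)$ is the space of derivations of this vertex algebra that are $\mathbb{C}((z))$-linear.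 *)

(* Defs.v *)
From HB Require Import structures.
From mathcomp Require Import all_boot all_order all_algebra.
From mathcomp Require Import all_classical reals complex.
From mathcomp Require Import zify ring.

Set Implicit Arguments.
Unset Strict Implicit.
Unset Printing Implicit Defensive.

Import Order.TTheory GRing.Theory Num.Theory.
Local Open Scope classical_set_scope.
Local Open Scope ring_scope.
Local Open Scope quotient_scope.
Section FiniteSupportSums.
Variable M : zmodType.

Lemma fsum_nat (F : nat -> M) (N : nat) :
  (forall k, (N <= k)%N -> F k = 0) ->
  \sum_(k \in [set: nat]) F k = \sum_(k < N) F k.
Proof.
move=> F0; rewrite (fsbig_ord +%R N F); apply/esym/fsbig_widen => //.
move=> k [_] /= /negP; rewrite -leqNgt; exact: F0.
Qed.

Lemma fsum_int (F : int -> M) (a : int) (N : nat) :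
  (forall i, i < a \/ a + N%:Z <= i -> F i = 0) ->
  \sum_(i \in [set: int]) F i = \sum_(k < N) F (a + k%:Z).
Proof.
move=> F0; rewrite (fsbig_ord +%R N (fun k => F (a + k%:Z))).
rewrite -(@fsbig_widen _ _ _ _ [set i : int | a <= i < a + N%:Z]) //; last first.
  by move=> i [_] /= /negP H; apply: F0; lia.
rewrite (@reindex_fsbig _ _ _ nat int (fun k : nat => a + k%:Z)
  [set k | (k < N)%N]) //.
split.
- by move=> k /=; lia.
- by move=> k l _ _ /=; lia.
- by move=> i /= Hi; exists `|i - a|%N; rewrite /=; lia.
Qed.

End FiniteSupportSums.

(* Formal Laurent series [\sum_n f n x^n] with coefficients in M: the family
   of coefficients vanishes for n small enough. *)
Section LaurentDef.
Variable M : zmodType.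

Definition bounded_below (f : int -> M) : Prop :=
  exists N : int, forall n, n < N -> f n = 0.

Record laurent := Laurent { lcoef :> int -> M; _ : `[< bounded_below lcoef >] }.

HB.instance Definition _ := [isSub for lcoef].
HB.instance Definition _ := [Choice of laurent by <:].

Definition mklaurent (f : int -> M) (H : bounded_below f) : laurent :=
  Laurent (asboolT H).

Lemma mklaurentE f H n : @mklaurent f H n = f n. Proof. by []. Qed.

Lemma laurent_bound (f : laurent) : bounded_below f.
Proof. by case: f => f H; apply/asboolP. Qed.

Lemma laurentP (f g : laurent) : f =1 g <-> f = g.
Proof. by split=> [H|-> //]; apply/val_inj/funext. Qed.

Lemma lzero_subproof : bounded_below (fun=> 0). Proof. by exists 0. Qed.
Definition lzero := mklaurent lzero_subproof.

Lemma lopp_subproof (f : laurent) : bounded_below (fun n => - f n).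
Proof. by case: (laurent_bound f) => N H; exists N => n /H ->; rewrite oppr0. Qed.
Definition lopp f := mklaurent (lopp_subproof f).

Lemma ladd_subproof (f g : laurent) : bounded_below (fun n => f n + g n).
Proof.
case: (laurent_bound f) => a Ha; case: (laurent_bound g) => b Hb.
by exists (Order.min a b) => n Hn; rewrite Ha ?Hb ?addr0 //; lia.
Qed.
Definition ladd f g := mklaurent (ladd_subproof f g).

Lemma laddA : associative ladd.
Proof. by move=> f g h; apply/laurentP => n; apply: addrA. Qed.
Lemma laddC : commutative ladd.
Proof. by move=> f g; apply/laurentP => n; apply: addrC. Qed.
Lemma ladd0 : left_id lzero ladd.
Proof. by move=> f; apply/laurentP => n; apply: add0r. Qed.
Lemma laddN : left_inverse lzero lopp ladd.
Proof. by move=> f; apply/laurentP => n; apply: addNr. Qed.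

HB.instance Definition _ := GRing.isZmodule.Build laurent laddA laddC ladd0 laddN.

Lemma lcoefD (f g : laurent) n : (f + g) n = f n + g n. Proof. by []. Qed.
Lemma lcoefN (f : laurent) n : (- f) n = - f n. Proof. by []. Qed.
Lemma lcoef0 n : (0 : laurent) n = 0. Proof. by []. Qed.
Lemma lcoef_sum I (r : seq I) (P : pred I) (F : I -> laurent) n :
  (\sum_(i <- r | P i) F i) n = \sum_(i <- r | P i) F i n.
Proof. by elim/big_rec2: _ => // i x y _ <-. Qed.

End LaurentDef.

Section LaurentLmod.
Variables (K : pzRingType) (M : lmodType K).

Lemma lscale_subproof c (f : laurent M) : bounded_below (fun n => c *: f n).
Proof. by case: (laurent_bound f) => N H; exists N => n /H ->; rewrite scaler0. Qed.
Definition lscale c f := mklaurent (lscale_subproof c f).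

Lemma lscaleA a b f : lscale a (lscale b f) = lscale (a * b) f.
Proof. by apply/laurentP => n; apply: scalerA. Qed.
Lemma lscale1 : left_id 1 lscale.
Proof. by move=> f; apply/laurentP => n; apply: scale1r. Qed.
Lemma lscaleDr : right_distributive lscale +%R.
Proof. by move=> c f g; apply/laurentP => n; apply: scalerDr. Qed.
Lemma lscaleDl f : {morph lscale^~ f : a b / a + b}.
Proof. by move=> a b; apply/laurentP => n; apply: scalerDl. Qed.

HB.instance Definition _ := GRing.Zmodule_isLmodule.Build K (laurent M)
  lscaleA lscale1 lscaleDr lscaleDl.

Lemma lcoefZ c (f : laurent M) n : (c *: f) n = c *: f n. Proof. by []. Qed.

End LaurentLmod.

Section LaurentRing.
Variable A : comNzRingType.

Lemma lmul_subproof (f g : laurent A) :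
  bounded_below (fun n => \sum_(i \in [set: int]) f i * g (n - i)).
Proof.
case: (laurent_bound f) => a Ha; case: (laurent_bound g) => b Hb.
exists (a + b) => n Hn; rewrite fsbig1 // => i _.
have [/Ha ->|Hi] := ltP i a; first by rewrite mul0r.
by rewrite Hb ?mulr0 //; lia.
Qed.
Definition lmul f g := mklaurent (lmul_subproof f g).
Arguments lmul : simpl never.

Lemma lmulE (f g : laurent A) (n s : int) (N : nat) (a b : int) :
  (forall i, i < a -> f i = 0) -> (forall i, i < b -> g i = 0) ->
  s <= a -> n < s + N%:Z + b ->
  lmul f g n = \sum_(k < N) f (s + k%:Z) * g (n - (s + k%:Z)).
Proof.
move=> Ha Hb Hs Hn; rewrite /lmul mklaurentE; apply: fsum_int => i [Hi|Hi].
  by rewrite Ha ?mul0r //; lia.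
by rewrite Hb ?mulr0 //; lia.
Qed.

Lemma lmulC : commutative lmul.
Proof.
move=> f g; apply/laurentP => n.
rewrite /lmul !mklaurentE (@reindex_fsbigT _ _ _ int int (fun i => n - i)).
  by apply: eq_fsbigr => i _; rewrite mulrC; congr (_ * _); congr (lcoef _ _); lia.
by exists (fun i => n - i) => i; lia.
Qed.

Lemma lmulA : associative lmul.
Proof.
move=> f g h; apply/laurentP => n.
case: (laurent_bound f) => a Ha; case: (laurent_bound g) => b Hb.
case: (laurent_bound h) => c Hc.
have Hgh i : i < b + c -> lmul g h i = 0.
  move=> Hi; rewrite (@lmulE g h i b 0 b c) ?big_ord0 //; lia.
have Hfg i : i < a + b -> lmul f g i = 0.
  move=> Hi; rewrite (@lmulE f g i a 0 a b) ?big_ord0 //; lia.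
pose N := (absz (n - a - b - c)%R).+1.
rewrite (@lmulE f (lmul g h) n a N a (b + c)) //; last by lia.
rewrite (@lmulE (lmul f g) h n (a + b) N (a + b) c) //; last by lia.
under [RHS]eq_bigr => k _.
  rewrite (@lmulE f g _ a N a b) //; last first.
    by have := ltn_ord k; lia.
  rewrite mulr_suml; over.
rewrite exchange_big; apply: eq_bigr => i _.
under [RHS]eq_bigr do rewrite -mulrA.
rewrite -mulr_sumr; congr (_ * _).
rewrite (@lmulE g h _ (b - i%:Z) N b c) //; [|lia|lia].
apply: eq_bigr => k _; congr (lcoef _ _ * lcoef _ _); lia.
Qed.

Lemma lmulDl : left_distributive lmul +%R.
Proof.
move=> f g h; apply/laurentP => n.
case: (laurent_bound f) => a Ha; case: (laurent_bound g) => b Hb.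
case: (laurent_bound h) => c Hc.
pose d := Order.min a b; pose N := (absz (n - d - c)%R).+1.
have Ha' i : i < d -> f i = 0 by move=> H; apply: Ha; lia.
have Hb' i : i < d -> g i = 0 by move=> H; apply: Hb; lia.
have Hab' i : i < d -> (f + g) i = 0.
  by move=> H; rewrite lcoefD Ha' // Hb' // addr0.
rewrite lcoefD !(@lmulE _ h n d N d c) //; [|lia..].
by rewrite -big_split; apply: eq_bigr => k _; rewrite lcoefD mulrDl.
Qed.

Lemma lconst_subproof (x : A) : bounded_below (fun n => if n == 0 then x else 0).
Proof. by exists 0 => n Hn; case: eqP => // ?; lia. Qed.
Definition lconst x := mklaurent (lconst_subproof x).

Lemma lconst_mul x f n : lmul (lconst x) f n = x * f n.
Proof.
case: (laurent_bound f) => a Ha; pose N := (absz (n - a)%R).+1.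
rewrite /lmul mklaurentE (@fsum_int _ _ 0 1) => [|i Hi].
  by rewrite big_ord1; congr (_ * lcoef f _); rewrite /=; lia.
by rewrite /= ifF ?mul0r //; lia.
Qed.

Lemma lmul1 : left_id (lconst 1) lmul.
Proof. by move=> f; apply/laurentP => n; rewrite lconst_mul mul1r. Qed.

Lemma lone_neq0 : lconst 1 != 0.
Proof. by apply/eqP => /laurentP/(_ 0)/eqP; rewrite /= oner_eq0. Qed.

HB.instance Definition _ := GRing.Zmodule_isComNzRing.Build (laurent A)
  lmulA lmulC lmul1 lmulDl lone_neq0.

Lemma lcoefM (f g : laurent A) n :
  (f * g) n = \sum_(i \in [set: int]) f i * g (n - i).
Proof. by []. Qed.
Lemma lcoefM_ord (f g : laurent A) (n s : int) (N : nat) (a b : int) :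
  (forall i, i < a -> f i = 0) -> (forall i, i < b -> g i = 0) ->
  s <= a -> n < s + N%:Z + b ->
  (f * g) n = \sum_(k < N) f (s + k%:Z) * g (n - (s + k%:Z)).
Proof. exact: lmulE. Qed.
Lemma lcoef1 n : (1 : laurent A) n = if n == 0 then 1 else 0. Proof. by []. Qed.

End LaurentRing.

Section LaurentAlg.
Variables (K : nzRingType) (A : comAlgType K).

Lemma lscaleAl c (f g : laurent A) : c *: (f * g) = c *: f * g.
Proof.
apply/laurentP => n.
case: (laurent_bound f) => a Ha; case: (laurent_bound g) => b Hb.
pose N := (absz (n - a - b)%R).+1.
rewrite lcoefZ !(@lcoefM_ord _ _ _ n a N a b) //; try lia; first last.
  by move=> i Hi; rewrite lcoefZ Ha // scaler0.
by rewrite scaler_sumr; apply: eq_bigr => k _; rewrite lcoefZ scalerAl.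
Qed.

HB.instance Definition _ := GRing.Lmodule_isLalgebra.Build K (laurent A) lscaleAl.
HB.instance Definition _ := GRing.Lalgebra_isComAlgebra.Build K (laurent A).

End LaurentAlg.

Section LaurentMap.
Variables (M N : zmodType) (phi : {additive M -> N}).

Lemma lmap_subproof (f : laurent M) : bounded_below (fun n => phi (f n)).
Proof. by case: (laurent_bound f) => a H; exists a => n /H ->; rewrite raddf0. Qed.
Definition lmap f := mklaurent (lmap_subproof f).

Lemma lmapE f n : lmap f n = phi (f n). Proof. by []. Qed.

End LaurentMap.

Section LaurentDeriv.

Section Zmod.
Variable M : zmodType.

Lemma lderiv_subproof (f : laurent M) :
  bounded_below (fun n => f (n + 1) *~ (n + 1)).
Proof.
case: (laurent_bound f) => a H; exists (a - 1) => n Hn.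
by rewrite H ?mul0rz //; lia.
Qed.

Definition lderiv f := mklaurent (lderiv_subproof f).

Lemma lderivE f n : lderiv f n = f (n + 1) *~ (n + 1). Proof. by []. Qed.

Lemma lderivD f g : lderiv (f + g) = lderiv f + lderiv g.
Proof. by apply/laurentP => n; rewrite lcoefD !lderivE lcoefD mulrzDl. Qed.
End Zmod.

Lemma lderivZ (K : pzRingType) (M : lmodType K) c (f : laurent M) :
  lderiv (c *: f) = c *: lderiv f.
Proof. by apply/laurentP => n; rewrite lcoefZ !lderivE lcoefZ scalerMzr. Qed.

Lemma lderivM (A : comNzRingType) (f g : laurent A) :
  lderiv (f * g) = lderiv f * g + f * lderiv g.
Proof.
apply/laurentP => n; rewrite lderivE lcoefD.
case: (laurent_bound f) => a Ha; case: (laurent_bound g) => b Hb.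
have Ha' i : i < a - 1 -> lderiv f i = 0.
  by move=> H; rewrite lderivE Ha ?mul0rz //; lia.
have Hb' i : i < b - 1 -> lderiv g i = 0.
  by move=> H; rewrite lderivE Hb ?mul0rz //; lia.
pose N := (absz (n + 1 - a - b)%R).+1.
rewrite (@lcoefM_ord _ f g _ a N a b) //; last by lia.
rewrite (@lcoefM_ord _ (lderiv f) g _ (a - 1) N (a - 1) b) //; last by lia.
rewrite (@lcoefM_ord _ f (lderiv g) _ a N a (b - 1)) //; last by lia.
rewrite mulrz_suml -big_split; apply: eq_bigr => k _.
rewrite !lderivE.
have -> : a - 1 + k%:Z + 1 = a + k%:Z by lia.
have -> : n - (a - 1 + k%:Z) = n + 1 - (a + k%:Z) by lia.
have -> : n - (a + k%:Z) + 1 = n + 1 - (a + k%:Z) by lia.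
by rewrite mulrzAl mulrzAr /= -mulrzDr; congr (_ *~ _); lia.
Qed.

End LaurentDeriv.

(* K^o is K as an algebra over itself, so laurent K^o is K((z)). For f in K((z)),
   taylor f lists the coefficients of [f(z+x) = e^(x d/dz) f(z)] in K((z))[[x]];
   power series over A are sequences nat -> A. *)
Section Taylor.
Variable K : numFieldType.
Notation L := (laurent K^o).

Definition taylor (f : L) : nat -> L := fun k => (k`!%:R)^-1 *: iter k (@lderiv _) f.

Lemma iter_lderivD k (f g : L) :
  iter k (@lderiv _) (f + g) = iter k (@lderiv _) f + iter k (@lderiv _) g.
Proof. by elim: k => //= k ->; rewrite lderivD. Qed.
Lemma iter_lderivZ k c (f : L) :
  iter k (@lderiv _) (c *: f) = c *: iter k (@lderiv _) f.
Proof. by elim: k => //= k ->; rewrite lderivZ. Qed.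

Lemma taylor_is_linear : linear taylor.
Proof.
move=> c f g; apply/funext => k; rewrite /taylor iter_lderivD iter_lderivZ.
by rewrite scalerDr !scalerA mulrC -scalerA.
Qed.
HB.instance Definition _ := GRing.isLinear.Build K L (nat -> L) _ taylor taylor_is_linear.

Lemma taylor0 f : taylor f 0 = f.
Proof. by rewrite /taylor /= invr1 scale1r. Qed.

Lemma factr_neq0 k : (k`!%:R : K) != 0.
Proof. by rewrite pnatr_eq0 -lt0n fact_gt0. Qed.

Lemma lderiv_taylor f k : lderiv (taylor f k) = k.+1%:R *: taylor f k.+1.
Proof.
rewrite /taylor lderivZ /= scalerA; congr (_ *: _).
by rewrite factS natrM invfM mulVKf // pnatr_eq0.
Qed.

Lemma taylor_taylor f k p : taylor (taylor f k) p = 'C(p + k, k)%:R *: taylor f (p + k).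
Proof.
rewrite /taylor iter_lderivZ -iterD !scalerA; congr (_ *: _).
have := bin_fact (leq_addl p k); rewrite addnK => <-.
rewrite !natrM !invfM mulVKf; first by rewrite mulrC.
by rewrite pnatr_eq0 -lt0n bin_gt0 leq_addl.
Qed.

Lemma lderiv_sum I (r : seq I) (P : pred I) (F : I -> L) :
  lderiv (\sum_(i <- r | P i) F i) = \sum_(i <- r | P i) lderiv (F i).
Proof.
elim/big_rec2: _ => [|i x y _ <-]; last exact: lderivD.
by apply/laurentP => n; rewrite lderivE !lcoef0 mul0rz.
Qed.

Lemma taylorM f g p :
  taylor (f * g) p = \sum_(i < p.+1) taylor f i * taylor g (p - i).
Proof.
elim: p => [|p IH]; first by rewrite big_ord1 subn0 !taylor0.
have p0 : (p.+1%:R : K) != 0 by rewrite pnatr_eq0.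
apply: (scalerI p0); rewrite -lderiv_taylor IH lderiv_sum scaler_sumr.
under eq_bigr => i _ do rewrite lderivM !lderiv_taylor -scalerAl -[X in _ + X]scalerAr.
rewrite big_split /=.
transitivity (\sum_(i < p.+2) (i%:R *: (taylor f i * taylor g (p.+1 - i))) +
              \sum_(i < p.+2) ((p.+1 - i)%:R *: (taylor f i * taylor g (p.+1 - i)))).
  congr (_ + _).
    by rewrite [RHS]big_ord_recl scale0r add0r; apply: eq_bigr => i _.
  rewrite [RHS]big_ord_recr /= subnn scale0r addr0; apply: eq_bigr => i _.
  by rewrite subSn // -ltnS.
rewrite -big_split; apply: eq_bigr => i _.
by rewrite /= -scalerDl -natrD subnKC // -ltnS.
Qed.

Lemma taylor_1 k : taylor 1 k = if k == 0%N then 1 else 0.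
Proof.
case: k => [|k]; first exact: taylor0.
suff H : iter k.+1 (@lderiv _) (1 : L) = 0 by rewrite /taylor H scaler0.
elim: k => [|k IH].
  apply/laurentP => n; rewrite iterS lderivE lcoef1 lcoef0.
  by case: eqP => [->|]; rewrite ?mulr0z ?mul0rz.
rewrite iterS IH; apply/laurentP => n; rewrite lderivE !lcoef0 mul0rz //.
Qed.

End Taylor.

(* The algebraic tensor product of A and V: finite formal sums of pairs (a, v),
   modulo the congruence generated by bilinearity. *)
Section TensorDef.
Variables (K : comNzRingType) (A V : lmodType K).

Inductive tens_eq : seq (A * V) -> seq (A * V) -> Prop :=
| tens_eq_refl s : tens_eq s s
| tens_eq_sym s t : tens_eq s t -> tens_eq t s
| tens_eq_trans s t r : tens_eq s t -> tens_eq t r -> tens_eq s r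
| tens_eq_cat s s' t t' : tens_eq s s' -> tens_eq t t' -> tens_eq (s ++ t) (s' ++ t')
| tens_eq_comm s t : tens_eq (s ++ t) (t ++ s)
| tens_eq_0 v : tens_eq [:: (0, v)] [::]
| tens_eq_Dl a b v : tens_eq [:: (a + b, v)] [:: (a, v); (b, v)]
| tens_eq_Dr a v w : tens_eq [:: (a, v + w)] [:: (a, v); (a, w)]
| tens_eq_Z c a v : tens_eq [:: (c *: a, v)] [:: (a, c *: v)].

Definition tens_rel : rel (seq (A * V)) := fun s t => `[< tens_eq s t >].

Lemma tens_rel_equiv : equiv_class_of tens_rel.
Proof.
split=> [s|s t|t s r].
- exact/asboolP/tens_eq_refl.
- by apply/asboolP/asboolP; apply: tens_eq_sym.
- by move=> /asboolP H1 /asboolP H2; apply/asboolP/(tens_eq_trans H1 H2).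
Qed.

Canonical tens_rel_equiv_rel := EquivRelPack tens_rel_equiv.

Definition tensor := {eq_quot tens_rel}.
HB.instance Definition _ : EqQuotient _ tens_rel tensor := EqQuotient.on tensor.
HB.instance Definition _ := Choice.on tensor.

Definition tclass (s : seq (A * V)) : tensor := \pi s.

Lemma tclassP s t : tclass s = tclass t <-> tens_eq s t.
Proof.
split=> [/eqmodP/asboolP //|H].
exact/eqmodP/asboolP.
Qed.

Lemma tclass_repr (x : tensor) : tclass (repr x) = x. Proof. exact: reprK. Qed.

Definition pscale (c : K) (s : seq (A * V)) := [seq (c *: p.1, p.2) | p <- s].

Lemma pscale_eq c s t : tens_eq s t -> tens_eq (pscale c s) (pscale c t).
Proof.
elim=> {s t}.
- by move=> s; apply: tens_eq_refl.
- by move=> s t _; apply: tens_eq_sym.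
- by move=> s t r _ H1 _ H2; apply: tens_eq_trans H1 H2.
- by move=> s s' t t' _ H1 _ H2; rewrite /pscale !map_cat; apply: tens_eq_cat.
- by move=> s t; rewrite /pscale !map_cat; apply: tens_eq_comm.
- by move=> v; rewrite /pscale /= scaler0; apply: tens_eq_0.
- by move=> a b v; rewrite /pscale /= scalerDr; apply: tens_eq_Dl.
- by move=> a v w; apply: tens_eq_Dr.
- by move=> d a v; rewrite /pscale /= scalerA mulrC -scalerA; apply: tens_eq_Z.
Qed.

Definition tzero := tclass [::].
Definition tadd (x y : tensor) := tclass (repr x ++ repr y).
Definition tscale c (x : tensor) := tclass (pscale c (repr x)).
Definition topp x := tscale (-1) x.

Lemma tclass_cat s t : tadd (tclass s) (tclass t) = tclass (s ++ t).
Proof. by apply/tclassP/tens_eq_cat; apply/tclassP; rewrite tclass_repr. Qed.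
Lemma tclass_scale c s : tscale c (tclass s) = tclass (pscale c s).
Proof. by apply/tclassP/pscale_eq; apply/tclassP; rewrite tclass_repr. Qed.

Lemma tclass_ind (P : tensor -> Prop) : (forall s, P (tclass s)) -> forall x, P x.
Proof. by move=> H x; rewrite -(tclass_repr x). Qed.

Lemma taddA : associative tadd.
Proof.
elim/tclass_ind=> s; elim/tclass_ind=> t; elim/tclass_ind=> r.
by rewrite !tclass_cat catA.
Qed.
Lemma taddC : commutative tadd.
Proof.
elim/tclass_ind=> s; elim/tclass_ind=> t; rewrite !tclass_cat.
exact/tclassP/tens_eq_comm.
Qed.
Lemma tadd0 : left_id tzero tadd.
Proof. by elim/tclass_ind=> s; rewrite tclass_cat. Qed.

Lemma tclass_cons p s : tclass (p :: s) = tadd (tclass [:: p]) (tclass s).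
Proof. by rewrite tclass_cat. Qed.

Lemma tscaleDl x : {morph tscale^~ x : a b / a + b >-> tadd a b}.
Proof.
elim/tclass_ind: x => s a b; rewrite !tclass_scale.
elim: s => [|[f v] s IH] /=; first by rewrite tadd0.
rewrite tclass_cons IH [tclass (_ :: pscale a s)]tclass_cons.
rewrite [tclass (_ :: pscale b s)]tclass_cons.
have -> : tclass [:: ((a + b) *: f, v)] =
    tadd (tclass [:: (a *: f, v)]) (tclass [:: (b *: f, v)]).
  by rewrite tclass_cat scalerDl; apply/tclassP/tens_eq_Dl.
rewrite -!taddA; congr tadd; rewrite !taddA; congr tadd; exact: taddC.
Qed.

Lemma tscale0 x : tscale 0 x = tzero.
Proof.
elim/tclass_ind: x => s; rewrite tclass_scale.
elim: s => [|[f v] s IH] //=; rewrite tclass_cons IH taddC tadd0 scale0r.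
exact/tclassP/tens_eq_0.
Qed.

Lemma tscale1 : left_id 1 tscale.
Proof.
elim/tclass_ind=> s; rewrite tclass_scale /pscale; congr tclass.
by rewrite -[RHS]map_id; apply: eq_map => -[f v]; rewrite scale1r.
Qed.

Lemma taddN : left_inverse tzero topp tadd.
Proof. by move=> x; rewrite -{2}(tscale1 x) -tscaleDl addNr tscale0. Qed.

HB.instance Definition _ := GRing.isZmodule.Build tensor taddA taddC tadd0 taddN.

Lemma tscaleA a b x : tscale a (tscale b x) = tscale (a * b) x.
Proof.
elim/tclass_ind: x => s; rewrite !tclass_scale /pscale -map_comp; congr tclass.
by apply: eq_map => -[f v]; rewrite /= scalerA.
Qed.
Lemma tscaleDr : right_distributive tscale +%R.
Proof.
move=> c; elim/tclass_ind=> s; elim/tclass_ind=> t.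
by rewrite [_ + _]tclass_cat !tclass_scale [RHS]tclass_cat /pscale map_cat.
Qed.

HB.instance Definition _ := GRing.Zmodule_isLmodule.Build K tensor
  tscaleA tscale1 tscaleDr tscaleDl.

Definition tens (a : A) (v : V) : tensor := tclass [:: (a, v)].

Lemma tensDl a b v : tens (a + b) v = tens a v + tens b v.
Proof. by rewrite [RHS]tclass_cat; apply/tclassP/tens_eq_Dl. Qed.
Lemma tensDr a v w : tens a (v + w) = tens a v + tens a w.
Proof. by rewrite [RHS]tclass_cat; apply/tclassP/tens_eq_Dr. Qed.
Lemma tensZl c a v : tens (c *: a) v = c *: tens a v.
Proof. by rewrite [RHS]tclass_scale. Qed.
Lemma tensZr c a v : tens a (c *: v) = c *: tens a v.
Proof. by rewrite -tensZl; apply/esym/tclassP/tens_eq_Z. Qed.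

Lemma tens_is_linear a : linear (tens a).
Proof. by move=> c v w; rewrite tensDr tensZr. Qed.
HB.instance Definition _ a := GRing.isLinear.Build K V tensor _ (tens a) (tens_is_linear a).
Lemma tens0l v : tens 0 v = 0.
Proof. by rewrite -(scale0r 0) tensZl scale0r. Qed.
Lemma tens0r a : tens a 0 = 0. Proof. exact: raddf0. Qed.
Lemma tens_suml I (r : seq I) (P : pred I) (F : I -> A) v :
  tens (\sum_(i <- r | P i) F i) v = \sum_(i <- r | P i) tens (F i) v.
Proof. by elim/big_rec2: _ => [|i x y _ <-]; rewrite ?tens0l ?tensDl. Qed.
Lemma tens_sumr I (r : seq I) (P : pred I) a (F : I -> V) :
  tens a (\sum_(i <- r | P i) F i) = \sum_(i <- r | P i) tens a (F i).
Proof. exact: raddf_sum. Qed.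

Lemma tclassE s : tclass s = \sum_(p <- s) tens p.1 p.2.
Proof.
elim: s => [|[a v] s IH]; first by rewrite big_nil.
by rewrite big_cons -IH tclass_cons.
Qed.

Lemma tens_ind (P : tensor -> Prop) :
  P 0 -> (forall x y, P x -> P y -> P (x + y)) -> (forall a v, P (tens a v)) ->
  forall x, P x.
Proof.
move=> P0 PD Pt; elim/tclass_ind=> s; rewrite tclassE.
by elim/big_ind: _ => // -[a v] _; apply: Pt.
Qed.

End TensorDef.

Lemma tens_linear_ext (K : comNzRingType) (A V W : lmodType K)
    (g h : {linear tensor A V -> W}) :
  (forall a v, g (tens a v) = h (tens a v)) -> g =1 h.
Proof.
move=> E; elim/tens_ind => [|x y Hx Hy|a v]; first by rewrite !raddf0.
  by rewrite !linearD Hx Hy.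
exact: E.
Qed.

(* The map [a (x) v |-> B a v] induced by a bilinear B, see tlift_tens. *)
Section TensorLift.
Variables (K : comNzRingType) (A V W : lmodType K).

Definition is_bilinear (B : A -> V -> W) : Prop :=
  (forall v, linear (B^~ v)) /\ (forall a, linear (B a)).

Definition tlift (B : A -> V -> W) (x : tensor A V) : W :=
  \sum_(p <- repr x) B p.1 p.2.

Variable B : A -> V -> W.
Hypothesis Bbil : is_bilinear B.

Let BDl a b v : B (a + b) v = B a v + B b v.
Proof. by have := Bbil.1 v 1 a b; rewrite !scale1r. Qed.
Let BDr a v w : B a (v + w) = B a v + B a w.
Proof. by have := Bbil.2 a 1 v w; rewrite !scale1r. Qed.
Let B0l v : B 0 v = 0.
Proof. by apply: (addrI (B 0 v)); rewrite -BDl !addr0. Qed.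
Let B0r a : B a 0 = 0.
Proof. by apply: (addrI (B a 0)); rewrite -BDr !addr0. Qed.
Let BZl c a v : B (c *: a) v = c *: B a v.
Proof. by have := Bbil.1 v c a 0; rewrite B0l !addr0. Qed.
Let BZr c a v : B a (c *: v) = c *: B a v.
Proof. by have := Bbil.2 a c v 0; rewrite B0r !addr0. Qed.

Lemma tlift_class s : tlift B (tclass s) = \sum_(p <- s) B p.1 p.2.
Proof.
have H : tens_eq (repr (tclass s)) s by apply/tclassP; rewrite tclass_repr.
rewrite /tlift; move: (repr _) H => r; elim=> {s r} //.
- by move=> s t r _ -> _ ->.
- by move=> s s' t t' _ H1 _ H2; rewrite !big_cat /= H1 H2.
- by move=> s t; rewrite !big_cat /= addrC.
- by move=> v; rewrite big_seq1 big_nil /= B0l.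
- by move=> a b v; rewrite big_seq1 big_cons big_seq1 /= BDl.
- by move=> a b v; rewrite big_seq1 big_cons big_seq1 /= BDr.
- by move=> c a v; rewrite !big_seq1 /= BZl BZr.
Qed.

Lemma tlift_tens a v : tlift B (tens a v) = B a v.
Proof. by rewrite tlift_class big_seq1. Qed.

Lemma tlift_linear : linear (tlift B).
Proof.
move=> c; elim/tclass_ind=> s; elim/tclass_ind=> t.
rewrite [_ *: _]tclass_scale [_ + _]tclass_cat !tlift_class big_cat.
congr (_ + _); rewrite /pscale big_map scaler_sumr; apply: eq_bigr => p _.
by rewrite BZl.
Qed.

Lemma tlift_unique (h : tensor A V -> W) :
  linear h -> (forall a v, h (tens a v) = B a v) -> h =1 tlift B.
Proof.
move=> hl hB; pose h' := GRing.isLinear.Build _ _ _ _ h hl.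
pose H : {linear tensor A V -> W} := HB.pack h h'.
pose l' := GRing.isLinear.Build _ _ _ _ (tlift B) tlift_linear.
pose l : {linear tensor A V -> W} := HB.pack (tlift B) l'.
by apply: (@tens_linear_ext _ _ _ _ H l) => a v; rewrite /H /l /= hB tlift_tens.
Qed.

End TensorLift.

Section TensorMap.
Variables (K : comNzRingType) (A V A' V' : lmodType K).
Variables (phi : {linear A -> A'}) (psi : {linear V -> V'}).

Definition tmap : tensor A V -> tensor A' V' :=
  tlift (fun a v => tens (phi a) (psi v)).

Lemma tmap_bilinear : is_bilinear (fun a v => tens (phi a) (psi v)).
Proof.
split=> [v c a b|a c v w]; first by rewrite linearP tensDl tensZl.
by rewrite linearP tensDr tensZr.
Qed.

Lemma tmap_is_linear : linear tmap. Proof. exact/tlift_linear/tmap_bilinear. Qed.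
HB.instance Definition _ :=
  GRing.isLinear.Build K (tensor A V) (tensor A' V') _ tmap tmap_is_linear.

Lemma tmap_tens a v : tmap (tens a v) = tens (phi a) (psi v).
Proof. exact/tlift_tens/tmap_bilinear. Qed.

End TensorMap.

(* u_n v, the coefficient of x^(-n-1) in Y(u,x)v. *)
Definition modes (V : zmodType) (Y : V -> V -> laurent V) (u : V) (n : int) (v : V) : V :=
  Y u v (- n - 1).

Definition gbinom (K : fieldType) (m : int) (i : nat) : K :=
  (\prod_(j < i) (m - j%:Z)%:~R) / i`!%:R.

(* The coefficient of x0^(-l-1) x1^(-m-1) x2^(-n-1) in the Jacobi identity; both
   sums are finite since Y takes values in Laurent series. *)
Definition borcherds_identity (K : numFieldType) (V : lmodType K)
    (Y : V -> V -> laurent V) : Prop :=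
  forall (u v w : V) (l m n : int),
  \sum_(i \in [set: nat])
     gbinom K m i *: modes Y (modes Y u (l + i%:Z) v) (m + n - i%:Z) w =
  \sum_(i \in [set: nat])
     ((-1) ^+ i * gbinom K l i) *:
       (modes Y u (m + l - i%:Z) (modes Y v (n + i%:Z) w) -
        (-1) ^ l *: modes Y v (n + l - i%:Z) (modes Y u (m + i%:Z) w)).

HB.mixin Record isVertexAlgebra (K : numFieldType) V of GRing.Lmodule K V := {
  vacuum : V;
  vop : V -> V -> laurent V;
  vop_linearl : forall v, linear (vop^~ v);
  vop_linearr : forall u, linear (vop u);
  vop_vacuuml : forall v n, vop vacuum v n = if n == 0 then v else 0;
  vop_vacuumr : forall v n, n <= 0 -> vop v vacuum n = if n == 0 then v else 0;
  vop_borcherds : borcherds_identity vop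
}.

#[short(type="vertexAlgType")]
HB.structure Definition VertexAlgebra (K : numFieldType) :=
  {V of isVertexAlgebra K V & GRing.Lmodule K V}.

Arguments vacuum {K s}.

Section GeneralizedBinomial.
Variable K : numFieldType.

Lemma gbinom0 m : gbinom K m 0 = 1.
Proof. by rewrite /gbinom big_ord0 divr1. Qed.

Lemma gbinomS m i : gbinom K (m + 1) i.+1 = gbinom K m i.+1 + gbinom K m i.
Proof.
have i0 : (i.+1%:R : K) != 0 by rewrite pnatr_eq0.
have f0 : (i`!%:R : K) != 0 by rewrite pnatr_eq0 -lt0n fact_gt0.
have -> : gbinom K (m + 1) i.+1 =
    (m + 1)%:~R * (\prod_(j < i) (m - j%:Z)%:~R) / i.+1`!%:R.
  rewrite /gbinom big_ord_recl subr0; congr (_ * _ / _).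
  by apply: eq_bigr => j _; congr _%:~R; rewrite lift0; lia.
rewrite /gbinom big_ord_recr /= factS natrM.
set P := \prod_(_ < _) _.
have -> : (i.+1%:R : K) = i%:R + 1 by rewrite -natr1.
rewrite !(intrD, intrB) mulr1z; field.
by rewrite f0 natr1 i0.
Qed.

Variable V : lmodType K.

Lemma gbinom_sumS m N (X : nat -> V) : (forall s, (N <= s)%N -> X s = 0) ->
  \sum_(s < N) gbinom K (m + 1) s *: X s =
  \sum_(s < N) gbinom K m s *: X s + \sum_(s < N) gbinom K m s *: X s.+1.
Proof.
case: N => [|N] HN; first by rewrite !big_ord0 addr0.
rewrite [RHS]addrC [X in _ = X + _]big_ord_recr /= HN // scaler0 addr0.
rewrite big_ord_recl [X in _ = _ + X]big_ord_recl !gbinom0 addrCA; congr (_ + _).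
rewrite -big_split; apply: eq_bigr => i _ /=.
by rewrite -scalerDl [gbinom K m i + _]addrC -gbinomS.
Qed.

Lemma gbinom_vandermonde m q N (X : nat -> V) :
  (forall s, (N <= s)%N -> X s = 0) ->
  \sum_(s < N) gbinom K (m + q%:Z) s *: X s =
  \sum_(k < q.+1) 'C(q, k)%:R *: \sum_(i < N) gbinom K m i *: X (i + k)%N.
Proof.
elim: q X => [|q IH] X HN.
  rewrite big_ord1 addr0 bin0 scale1r; apply: eq_bigr => i _.
  by rewrite addn0.
have -> : m + q.+1%:Z = m + q%:Z + 1 by lia.
have HN' s : (N <= s)%N -> X s.+1 = 0 by move=> H; apply: HN; lia.
rewrite gbinom_sumS // IH // (IH (fun s => X s.+1)) //.
pose T k := \sum_(i < N) gbinom K m i *: X (i + k)%N.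
rewrite -[LHS]/(\sum_(k < q.+1) 'C(q, k)%:R *: T k + _) -[RHS]/(\sum_(k < q.+2) 'C(q.+1, k)%:R *: T k).
have -> : \sum_(k < q.+1) 'C(q, k)%:R *: (\sum_(i < N) gbinom K m i *: X (i + k).+1) =
   \sum_(k < q.+1) 'C(q, k)%:R *: T k.+1.
  by apply: eq_bigr => k _; congr (_ *: _); apply: eq_bigr => i _; rewrite addnS.
rewrite [RHS]big_ord_recl.
under [in RHS]eq_bigr => k _ do rewrite /= /bump /= add1n binS natrD scalerDl.
rewrite [X in _ = _ + X]big_split /= addrA; congr (_ + _).
rewrite big_ord_recl !bin0; congr (_ + _).
rewrite [RHS]big_ord_recr /= bin_small // scale0r addr0.
by apply: eq_bigr => k _; rewrite /bump /= add1n.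
Qed.

End GeneralizedBinomial.

Lemma sum_triangle (M : zmodType) (B : nat) (F : nat -> nat -> M) :
  (forall a p, (B <= a + p)%N -> F a p = 0) ->
  \sum_(r < B) \sum_(a < r.+1) F a (r - a)%N = \sum_(a < B) \sum_(p < B) F a p.
Proof.
move=> HF.
have E1 (r : 'I_B) : \sum_(a < r.+1) F a (r - a)%N =
    \sum_(a < B | (a <= r)%N) F a (r - a)%N.
  rewrite (big_ord_widen B (fun a => F a (r - a)%N)) //.
under eq_bigr => r _ do rewrite E1.
rewrite (exchange_big_dep xpredT) //=; apply: eq_bigr => a _.
rewrite -(big_mkord (fun r => a <= r)%N (fun r => F a (r - a)%N)).
rewrite -(big_mkord xpredT (fun p => F a p)).
rewrite (big_cat_nat (n := a)) //=; last by apply: ltnW.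
rewrite [X in X + _]big_nat_cond big_pred0 ?add0r; last by move=> i; lia.
rewrite [RHS](@big_cat_nat _ _ _ (B - a)%N) //=; last by lia.
rewrite [X in _ = _ + X]big_nat_cond [X in _ = _ + X]big1 ?addr0; last first.
  by move=> p Hp; apply: HF; lia.
rewrite -{1}(add0n a) big_addn.
rewrite [LHS]big_mkcond; apply: eq_bigr => p _.
by rewrite leq_addl addnK.
Qed.

(* The product of F(x) in A[[x]] and w(x) in V((x)), in (A (x) V)((x)). *)
Section SeriesTensor.
Variables (K : comNzRingType) (A V : lmodType K).

Lemma ltens_subproof (F : nat -> A) (w : laurent V) :
  bounded_below (fun n => \sum_(k \in [set: nat]) tens (F k) (w (n - k%:Z))).
Proof.
case: (laurent_bound w) => a Ha; exists a => n Hn; rewrite fsbig1 // => k _.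
by rewrite Ha ?tens0r //; lia.
Qed.
Definition ltens F w := mklaurent (ltens_subproof F w).

Lemma ltensE F (w : laurent V) (n : int) N :
  (forall k, (N <= k)%N -> w (n - k%:Z) = 0) ->
  ltens F w n = \sum_(k < N) tens (F k) (w (n - k%:Z)).
Proof.
by move=> H; rewrite /ltens mklaurentE; apply: fsum_nat => k /H ->; rewrite tens0r.
Qed.

Lemma lbound_nat (w : laurent V) n :
  exists N, forall k, (N <= k)%N -> w (n - k%:Z) = 0.
Proof.
case: (laurent_bound w) => a Ha; exists (absz (n - a)%R).+1 => k Hk.
by apply: Ha; lia.
Qed.

Lemma ltens_bilinear : is_bilinear ltens.
Proof.
split=> [w c F G|F c v w]; apply/laurentP => n; rewrite lcoefD lcoefZ.
  have [N HN] := lbound_nat w n.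
  rewrite !(ltensE _ HN) scaler_sumr -big_split; apply: eq_bigr => k _.
  by rewrite fctE /= tensDl tensZl.
have [N1 H1] := lbound_nat v n; have [N2 H2] := lbound_nat w n.
pose N := maxn N1 N2.
have Hv k : (N <= k)%N -> v (n - k%:Z) = 0 by move=> H; apply: H1; lia.
have Hw k : (N <= k)%N -> w (n - k%:Z) = 0 by move=> H; apply: H2; lia.
rewrite (@ltensE F (c *: v + w) n N) ?(ltensE _ Hv) ?(ltensE _ Hw); last first.
  by move=> k Hk; rewrite lcoefD lcoefZ Hv // Hw // scaler0 addr0.
rewrite scaler_sumr -big_split; apply: eq_bigr => k _.
by rewrite lcoefD lcoefZ /= tensDr tensZr.
Qed.

Lemma ltens_linl w : linear (ltens^~ w).
Proof. exact: (ltens_bilinear.1 w). Qed.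
Lemma ltens_linr F : linear (ltens F).
Proof. exact: (ltens_bilinear.2 F). Qed.

End SeriesTensor.

Section BilinearFacts.
Variables (K : comNzRingType) (A V W : lmodType K) (B : A -> V -> W).
Hypothesis Bbil : is_bilinear B.

Lemma bilinearDl a b v : B (a + b) v = B a v + B b v.
Proof. by have := Bbil.1 v 1 a b; rewrite !scale1r. Qed.
Lemma bilinearDr a v w : B a (v + w) = B a v + B a w.
Proof. by have := Bbil.2 a 1 v w; rewrite !scale1r. Qed.
Lemma bilinear0l v : B 0 v = 0.
Proof. by apply: (addrI (B 0 v)); rewrite -bilinearDl !addr0. Qed.
Lemma bilinear0r a : B a 0 = 0.
Proof. by apply: (addrI (B a 0)); rewrite -bilinearDr !addr0. Qed.

End BilinearFacts.

Section BilinearLaurent.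
Variables (K : numFieldType) (V : lmodType K) (Y : V -> V -> laurent V).
Hypothesis Ybil : is_bilinear Y.

Lemma modes_linl v n : linear (fun u => modes Y u n v).
Proof. by move=> c a b; rewrite /modes (Ybil.1 v c a b) lcoefD lcoefZ. Qed.
Lemma modes_linr u n : linear (modes Y u n).
Proof. by move=> c a b; rewrite /modes (Ybil.2 u c a b) lcoefD lcoefZ. Qed.
Lemma modesDl u u' n v : modes Y (u + u') n v = modes Y u n v + modes Y u' n v.
Proof. by have := modes_linl v n 1 u u'; rewrite !scale1r. Qed.
Lemma modesDr u n v v' : modes Y u n (v + v') = modes Y u n v + modes Y u n v'.
Proof. by have := modes_linr u n 1 v v'; rewrite !scale1r. Qed.
Lemma modes0l n v : modes Y 0 n v = 0.
Proof. by apply: (addrI (modes Y 0 n v)); rewrite -modesDl !addr0. Qed.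
Lemma modes0r u n : modes Y u n 0 = 0.
Proof. by apply: (addrI (modes Y u n 0)); rewrite -modesDr !addr0. Qed.
Lemma modes_sumr u n I (r : seq I) (P : pred I) (F : I -> V) :
  modes Y u n (\sum_(i <- r | P i) F i) = \sum_(i <- r | P i) modes Y u n (F i).
Proof. by elim/big_rec2: _ => [|i x y _ <-]; rewrite ?modes0r ?modesDr. Qed.
Lemma modes_suml v n I (r : seq I) (P : pred I) (F : I -> V) :
  modes Y (\sum_(i <- r | P i) F i) n v = \sum_(i <- r | P i) modes Y (F i) n v.
Proof. by elim/big_rec2: _ => [|i x y _ <-]; rewrite ?modes0l ?modesDl. Qed.

Lemma modes_trunc u v n : exists N, forall k, (N <= k)%N -> modes Y u (n + k%:Z) v = 0.
Proof.
have [N HN] := lbound_nat (Y u v) (- n - 1); exists N => k /HN E.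
by rewrite /modes -[RHS]E; congr (lcoef _ _); lia.
Qed.

Lemma modes_trunc_fam (u v : nat -> V) (n : nat -> int) M :
  exists N, forall i k, (i < M)%N -> (N <= k)%N -> modes Y (u i) (n i + k%:Z) (v i) = 0.
Proof.
elim: M => [|M [N IH]]; first by exists 0%N.
have [N' H'] := modes_trunc (u M) (v M) (n M).
exists (maxn N N') => i k; rewrite ltnS leq_eqVlt => /orP[/eqP -> Hk|Hi Hk].
  by apply: H'; lia.
by apply: IH => //; lia.
Qed.

Definition jacL u v w (l m n : int) i : V :=
  gbinom K m i *: modes Y (modes Y u (l + i%:Z) v) (m + n - i%:Z) w.
Definition jacR u v w (l m n : int) i : V :=
  ((-1) ^+ i * gbinom K l i) *:
       (modes Y u (m + l - i%:Z) (modes Y v (n + i%:Z) w) -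
        (-1) ^ l *: modes Y v (n + l - i%:Z) (modes Y u (m + i%:Z) w)).

Lemma jacL_trunc u v w l m n :
  exists N, forall i, (N <= i)%N -> jacL u v w l m n i = 0.
Proof.
have [N HN] := modes_trunc u v l; exists N => i Hi.
by rewrite /jacL HN // modes0l scaler0.
Qed.
Lemma jacR_trunc u v w l m n :
  exists N, forall i, (N <= i)%N -> jacR u v w l m n i = 0.
Proof.
have [N1 H1] := modes_trunc v w n; have [N2 H2] := modes_trunc u w m.
exists (maxn N1 N2) => i Hi.
rewrite /jacR H1 ?H2; [|lia|lia].
by rewrite !modes0r scaler0 subr0 scaler0.
Qed.

Definition jac u v w l m n :=
  \sum_(i \in [set: nat]) jacL u v w l m n i = \sum_(i \in [set: nat]) jacR u v w l m n i.

Lemma fsumD_nat (M : zmodType) (F G H : nat -> M) :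
  (exists N, forall i, (N <= i)%N -> F i = 0) ->
  (exists N, forall i, (N <= i)%N -> G i = 0) ->
  (forall i, H i = F i + G i) ->
  \sum_(i \in [set: nat]) H i =
  \sum_(i \in [set: nat]) F i + \sum_(i \in [set: nat]) G i.
Proof.
move=> [N1 H1] [N2 H2] E.
have HF i : (maxn N1 N2 <= i)%N -> F i = 0 by move=> H0; apply: H1; lia.
have HG i : (maxn N1 N2 <= i)%N -> G i = 0 by move=> H0; apply: H2; lia.
rewrite (fsum_nat HF) (fsum_nat HG) (@fsum_nat _ H (maxn N1 N2)); last first.
  by move=> i Hi; rewrite E HF // HG // addr0.
by rewrite -big_split; apply: eq_bigr => i _.
Qed.

Lemma jacD u v w u1 v1 w1 u2 v2 w2 l m n :
  (forall i, jacL u v w l m n i = jacL u1 v1 w1 l m n i + jacL u2 v2 w2 l m n i) ->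
  (forall i, jacR u v w l m n i = jacR u1 v1 w1 l m n i + jacR u2 v2 w2 l m n i) ->
  jac u1 v1 w1 l m n -> jac u2 v2 w2 l m n -> jac u v w l m n.
Proof.
move=> HL HR E1 E2; rewrite /jac.
rewrite (fsumD_nat (jacL_trunc _ _ _ _ _ _) (jacL_trunc _ _ _ _ _ _) HL).
rewrite (fsumD_nat (jacR_trunc _ _ _ _ _ _) (jacR_trunc _ _ _ _ _ _) HR).
by rewrite E1 E2.
Qed.

Lemma jac0 u v w l m n : [\/ u = 0, v = 0 | w = 0] -> jac u v w l m n.
Proof.
move=> H; rewrite /jac !fsbig1 // => i _; rewrite /jacR /jacL;
  case: H => ->; rewrite ?(modes0l, modes0r, scaler0, subr0) //.
Qed.

Lemma jacDu u1 u2 v w l m n :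
  jac u1 v w l m n -> jac u2 v w l m n -> jac (u1 + u2) v w l m n.
Proof.
apply: jacD => i; first by rewrite /jacL !modesDl scalerDr.
rewrite /jacR !(modesDl, modesDr) -scalerDr; congr (_ *: _).
by rewrite scalerDr opprD addrACA.
Qed.
Lemma jacDv u v1 v2 w l m n :
  jac u v1 w l m n -> jac u v2 w l m n -> jac u (v1 + v2) w l m n.
Proof.
apply: jacD => i; first by rewrite /jacL modesDr !modesDl scalerDr.
rewrite /jacR !(modesDl, modesDr) -scalerDr; congr (_ *: _).
by rewrite scalerDr opprD addrACA.
Qed.
Lemma jacDw u v w1 w2 l m n :
  jac u v w1 l m n -> jac u v w2 l m n -> jac u v (w1 + w2) l m n.
Proof.
apply: jacD => i; first by rewrite /jacL !modesDr scalerDr.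
rewrite /jacR !modesDr -scalerDr; congr (_ *: _).
by rewrite scalerDr opprD addrACA.
Qed.

Lemma jacL_unif u v w (l m n : int) :
  exists N, forall B, (N <= B)%N ->
   (forall j, (B <= j)%N -> modes Y u (l + j%:Z) v = 0) /\
   (forall j r (s : nat), (s <= j)%N -> (B <= j + r)%N ->
     modes Y (modes Y u (l + j%:Z) v) (m + n - s%:Z + r%:Z) w = 0).
Proof.
have [N1 H1] := modes_trunc u v l.
have [N2 H2] := modes_trunc_fam (fun j => modes Y u (l + j%:Z) v) (fun=> w)
  (fun _ => m + n - N1%:Z) N1.
exists (N1 + N1 + N2)%N => B HB; split=> [j Hj|j r s Hs Hr]; first by apply: H1; lia.
have [Hj|Hj] := leqP N1 j; first by rewrite H1 // modes0l.
have -> : m + n - s%:Z + r%:Z = m + n - N1%:Z + (N1 - s + r)%N%:Z by lia.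
by apply: H2 => //; lia.
Qed.

Lemma jacR_unif u v w (l m n : int) :
  exists N, forall B, (N <= B)%N ->
   (forall j, (B <= j)%N -> modes Y v (n + j%:Z) w = 0) /\
   (forall j r (s : nat), (s <= j)%N -> (B <= j + r)%N ->
     modes Y u (m + l - s%:Z + r%:Z) (modes Y v (n + j%:Z) w) = 0).
Proof.
have [N1 H1] := modes_trunc v w n.
have [N2 H2] := modes_trunc_fam (fun=> u) (fun j => modes Y v (n + j%:Z) w)
  (fun _ => m + l - N1%:Z) N1.
exists (N1 + N1 + N2)%N => B HB; split=> [j Hj|j r s Hs Hr]; first by apply: H1; lia.
have [Hj|Hj] := leqP N1 j; first by rewrite H1 // modes0r.
have -> : m + l - s%:Z + r%:Z = m + l - N1%:Z + (N1 - s + r)%N%:Z by lia.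
by apply: H2 => //; lia.
Qed.

End BilinearLaurent.

Section TensorVertexAlgebra.
Variables (K : numFieldType) (V : vertexAlgType K).
Notation L := (laurent K^o).
Notation LV := (tensor L V).

(* Y^(f (x) u, x)(g (x) v) = f(z+x) g(z) (x) Y(u,x)v *)
Definition tvop_pure (f : L) (u : V) (g : L) (v : V) : laurent LV :=
  ltens (fun k => taylor f k * g) (vop u v).

Definition tvop (x y : LV) : laurent LV :=
  tlift (fun f u => tlift (fun g v => tvop_pure f u g v) y) x.

Lemma vop_bilinear : is_bilinear (@vop K V).
Proof. by split; [exact: vop_linearl | exact: vop_linearr]. Qed.

Lemma tvop_pure_bilinr f u : is_bilinear (tvop_pure f u).
Proof.
split=> [v c g h|g c v w]; rewrite /tvop_pure.
  rewrite -[RHS]ltens_linl; congr (ltens _ _); apply/funext => k.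
  by rewrite mulrDr -scalerAr.
by rewrite vop_linearr ltens_linr.
Qed.

Lemma tvop_bilinl y : is_bilinear (fun f u => tlift (tvop_pure f u) y).
Proof.
split=> [u c f g|f c u v]; rewrite /tlift scaler_sumr -big_split;
  apply: eq_bigr => p _ /=; rewrite /tvop_pure.
  rewrite -[RHS]ltens_linl; congr (ltens _ _); apply/funext => k.
  by rewrite linearP mulrDl -scalerAl.
by rewrite vop_linearl ltens_linr.
Qed.

Lemma tvop_tens f u g v :
  tvop (tens f u) (tens g v) = ltens (fun k => taylor f k * g) (vop u v).
Proof.
rewrite /tvop tlift_tens; last exact: tvop_bilinl.
exact/tlift_tens/tvop_pure_bilinr.
Qed.

Lemma tvop_linearl y : linear (tvop^~ y).
Proof. exact/tlift_linear/tvop_bilinl. Qed.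
Lemma tvop_linearr x : linear (tvop x).
Proof.
move=> c y y'; rewrite /tvop /tlift scaler_sumr -big_split; apply: eq_bigr => p _.
exact/tlift_linear/tvop_pure_bilinr.
Qed.
Lemma tvop_bilinear : is_bilinear tvop.
Proof. by split; [exact: tvop_linearl | exact: tvop_linearr]. Qed.

Definition tvacuum : LV := tens 1 vacuum.

Lemma tvop_vacuuml y n : tvop tvacuum y n = if n == 0 then y else 0.
Proof.
elim/tens_ind: y => [|x y Hx Hy|g v].
- by rewrite (bilinear0r tvop_bilinear) lcoef0 if_same.
- rewrite (bilinearDr tvop_bilinear) lcoefD Hx Hy.
  by case: eqP => _; rewrite ?addr0.
rewrite tvop_tens (@ltensE _ _ _ _ _ _ `|n|.+1); last first.
  by move=> k Hk; rewrite vop_vacuuml ifF //; lia.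
rewrite big_ord_recl big1 => [|k _].
  by rewrite addr0 /= taylor_1 mul1r subr0 vop_vacuuml; case: eqP => // _; rewrite tens0r.
by rewrite taylor_1 mul0r tens0l.
Qed.

Lemma tvop_vacuumr x n : n <= 0 -> tvop x tvacuum n = if n == 0 then x else 0.
Proof.
move=> Hn; elim/tens_ind: x => [|x y Hx Hy|f u].
- by rewrite (bilinear0l tvop_bilinear) lcoef0 if_same.
- rewrite (bilinearDl tvop_bilinear) lcoefD Hx Hy.
  by case: eqP => _; rewrite ?addr0.
rewrite tvop_tens (@ltensE _ _ _ _ _ _ 1); last first.
  by move=> k Hk; rewrite vop_vacuumr ?ifF //; lia.
rewrite big_ord1 taylor0 mulr1 subr0 vop_vacuumr //.
by case: eqP => // _; rewrite tens0r.
Qed.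

Lemma tmode_tens f u g v n N :
  (forall k, (N <= k)%N -> modes vop u (n + k%:Z) v = 0) ->
  modes tvop (tens f u) n (tens g v) =
  \sum_(k < N) tens (taylor f k * g) (modes vop u (n + k%:Z) v).
Proof.
move=> H; rewrite /modes tvop_tens (@ltensE _ _ _ _ _ _ N); last first.
  by move=> k /H; rewrite /modes => <-; congr (lcoef _ _); lia.
by apply: eq_bigr => k _; congr (tens _ (lcoef _ _)); lia.
Qed.

Section Pure.
Variables (f g h : L) (u v w : V) (l m n : int).

Let c (q p : nat) : L := taylor f q * taylor g p * h.
Notation Y := (@vop K V).

Lemma tjacL_pure : exists N, forall B, (N <= B)%N ->
  \sum_(i \in [set: nat]) jacL tvop (tens f u) (tens g v) (tens h w) l m n i =
  \sum_(q < B) \sum_(p < B) tens (c q p)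
     (\sum_(i \in [set: nat]) jacL Y u v w l (m + q%:Z) (n + p%:Z) i).
Proof.
have [N HN] := jacL_unif vop_bilinear u v w l m n.
exists N => B HB; have [H1 H2] := HN B HB.
pose Z i k r : V := modes Y (modes Y u (l + (i + k)%N%:Z) v) (m + n - i%:Z + r%:Z) w.
have Z0 i k r : (B <= i + k + r)%N -> Z i k r = 0.
  by move=> H; apply: H2 => //; lia.
have HT (i : nat) : jacL tvop (tens f u) (tens g v) (tens h w) l m n i =
  gbinom K m i *: \sum_(k < B) \sum_(a < B) \sum_(p < B)
    'C(a + k, k)%:R *: tens (c (a + k) p) (Z i k (a + p)%N).
  rewrite /jacL; congr (_ *: _).
  rewrite (@tmode_tens f u g v _ B); last first.
    by move=> k Hk; rewrite -addrA -PoszD H1 //; lia.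
  rewrite (modes_suml tvop_bilinear); apply: eq_bigr => k _.
  rewrite (@tmode_tens _ _ h w _ B); last first.
    by move=> r Hr; rewrite -[l + _ + _]addrA -PoszD; apply: (Z0 i k); lia.
  pose F a p := 'C(a + k, k)%:R *: tens (c (a + k)%N p) (Z i k (a + p)%N).
  rewrite -[RHS](@sum_triangle _ B F); last first.
    by move=> a p Hap; rewrite /F Z0 ?tens0r ?scaler0 //; lia.
  apply: eq_bigr => r _; rewrite taylorM mulr_suml tens_suml.
  apply: eq_bigr => a _; rewrite /F /c /Z subnKC; last by rewrite -ltnS.
  by rewrite taylor_taylor -!scalerAl tensZl -[l + _ + _]addrA -PoszD.
transitivity (\sum_(i \in [set: nat]) gbinom K m i *: \sum_(k < B) \sum_(a < B)
    \sum_(p < B) 'C(a + k, k)%:R *: tens (c (a + k) p) (Z i k (a + p)%N)).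
  by apply: eq_fsbigr => i _; exact: HT.
rewrite (@fsum_nat _ _ B); last first.
  move=> i Hi; apply/eqP; rewrite scaler_eq0; apply/orP; right.
  apply/eqP; rewrite big1 // => k _; rewrite big1 // => a _; rewrite big1 // => p _.
  by rewrite Z0 ?tens0r ?scaler0 //; lia.
have HR (q p : nat) :
    \sum_(i \in [set: nat]) jacL Y u v w l (m + q%:Z) (n + p%:Z) i =
    \sum_(k < q.+1) 'C(q, k)%:R *:
       \sum_(i < B) gbinom K m i *: Z i k (q - k + p)%N.
  pose X s := modes Y (modes Y u (l + s%:Z) v) (m + q%:Z + (n + p%:Z) - s%:Z) w.
  have X0 s : (B <= s)%N -> X s = 0.
    by move=> Hs; rewrite /X H1 // (modes0l vop_bilinear).
  rewrite (@fsum_nat _ _ B); last by move=> i /X0 E; rewrite /jacL -/(X i) E scaler0.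
  rewrite -[LHS]/(\sum_(s < B) gbinom K (m + q%:Z) s *: X s) gbinom_vandermonde //.
  apply: eq_bigr => k _; congr (_ *: _); apply: eq_bigr => i _; congr (_ *: _).
  rewrite /X /Z; congr (modes Y _ _ w); have := ltn_ord k; lia.
under [RHS]eq_bigr => q _ do under eq_bigr => p _ do rewrite HR tens_sumr.
pose G k a : LV := \sum_(p < B) \sum_(i < B)
   (gbinom K m i * 'C(a + k, k)%:R) *: tens (c (a + k) p) (Z i k (a + p)%N).
transitivity (\sum_(k < B) \sum_(a < B) G k a).
  under eq_bigr => i _.
    rewrite scaler_sumr; under eq_bigr => k _.
      rewrite scaler_sumr; under eq_bigr => a _.
        rewrite scaler_sumr; under eq_bigr => p _ do rewrite scalerA.
        over.
      over.
    over.
  rewrite exchange_big; apply: eq_bigr => k _ /=.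
  rewrite exchange_big; apply: eq_bigr => a _ /=.
  by rewrite exchange_big.
rewrite -(@sum_triangle _ B G); last first.
  move=> k a Hka; rewrite /G big1 // => p _; rewrite big1 // => i _.
  by rewrite Z0 ?tens0r ?scaler0 //; lia.
apply: eq_bigr => q _; rewrite exchange_big; apply: eq_bigr => k _.
rewrite /G; apply: eq_bigr => p _; rewrite tensZr tens_sumr scaler_sumr.
apply: eq_bigr => i _; rewrite tensZr scalerA mulrC subnK //.
by rewrite -ltnS.
Qed.

Lemma tjacR_pure : exists N, forall B, (N <= B)%N ->
  \sum_(i \in [set: nat]) jacR tvop (tens f u) (tens g v) (tens h w) l m n i =
  \sum_(q < B) \sum_(p < B) tens (c q p)
     (\sum_(i \in [set: nat]) jacR Y u v w l (m + q%:Z) (n + p%:Z) i).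
Proof.
have [N1 HN1] := jacR_unif vop_bilinear u v w l m n.
have [N2 HN2] := jacR_unif vop_bilinear v u w l n m.
exists (maxn N1 N2) => B HB.
have [|H1 H2] := HN1 B; first by lia.
have [|H3 H4] := HN2 B; first by lia.
pose Z1 i q p := modes Y u (m + l - i%:Z + q%:Z) (modes Y v (n + i%:Z + p%:Z) w).
pose Z2 i q p := modes Y v (n + l - i%:Z + p%:Z) (modes Y u (m + i%:Z + q%:Z) w).
have Z10 i q p : (B <= i + p + q)%N -> Z1 i q p = 0.
  by move=> H; rewrite /Z1 -[n + _ + _]addrA -PoszD; apply: H2; lia.
have Z20 i q p : (B <= i + p + q)%N -> Z2 i q p = 0.
  by move=> H; rewrite /Z2 -[m + _ + _]addrA -PoszD; apply: H4; lia.
pose e i : K := (-1) ^+ i * gbinom K l i.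
have HT (i : nat) : jacR tvop (tens f u) (tens g v) (tens h w) l m n i =
   \sum_(q < B) \sum_(p < B) tens (c q p) (e i *: (Z1 i q p - (-1) ^ l *: Z2 i q p)).
  rewrite /jacR -/(e i).
  have -> : modes tvop (tens f u) (m + l - i%:Z)
      (modes tvop (tens g v) (n + i%:Z) (tens h w)) =
      \sum_(q < B) \sum_(p < B) tens (c q p) (Z1 i q p).
    rewrite (@tmode_tens g v h w _ B); last first.
      by move=> k Hk; rewrite -addrA -PoszD H1 //; lia.
    rewrite (modes_sumr tvop_bilinear) [RHS]exchange_big; apply: eq_bigr => p _.
    rewrite (@tmode_tens f u _ _ _ B) => [|q Hq]; last by apply: Z10; lia.
    by apply: eq_bigr => q _; rewrite /c mulrA.
  have -> : modes tvop (tens g v) (n + l - i%:Z)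
      (modes tvop (tens f u) (m + i%:Z) (tens h w)) =
      \sum_(q < B) \sum_(p < B) tens (c q p) (Z2 i q p).
    rewrite (@tmode_tens f u h w _ B); last first.
      by move=> k Hk; rewrite -addrA -PoszD H3 //; lia.
    rewrite (modes_sumr tvop_bilinear); apply: eq_bigr => q _.
    rewrite (@tmode_tens g v _ _ _ B) => [|p Hp]; last by apply: Z20; lia.
    by apply: eq_bigr => p _; rewrite /c mulrA [taylor g p * _]mulrC.
  rewrite scaler_sumr -sumrB scaler_sumr; apply: eq_bigr => q _.
  rewrite scaler_sumr -sumrB scaler_sumr; apply: eq_bigr => p _.
  by rewrite !(raddfB, tensZr) /= tensZr.
transitivity (\sum_(i \in [set: nat]) \sum_(q < B) \sum_(p < B)
    tens (c q p) (e i *: (Z1 i q p - (-1) ^ l *: Z2 i q p))).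
  by apply: eq_fsbigr => i _; exact: HT.
rewrite (@fsum_nat _ _ B); last first.
  move=> i Hi; rewrite big1 // => q _; rewrite big1 // => p _.
  by rewrite Z10 ?Z20 ?(scaler0, subr0, tens0r) //; lia.
rewrite exchange_big; apply: eq_bigr => q _ /=.
rewrite exchange_big; apply: eq_bigr => p _ /=.
have E i : jacR Y u v w l (m + q%:Z) (n + p%:Z) i =
    e i *: (Z1 i q p - (-1) ^ l *: Z2 i q p).
  rewrite /jacR -/(e i) /Z1 /Z2; congr (_ *: (modes Y _ _ (modes Y _ _ _) - _ *: modes Y _ _ (modes Y _ _ _))); lia.
rewrite (@fsum_nat _ _ B); last first.
  by move=> i Hi; rewrite E Z10 ?Z20 ?(scaler0, subr0) //; lia.
by rewrite tens_sumr; apply: eq_bigr => i _; rewrite E.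
Qed.

Lemma tjac_pure : jac tvop (tens f u) (tens g v) (tens h w) l m n.
Proof.
have [N1 H1] := tjacL_pure; have [N2 H2] := tjacR_pure.
rewrite /jac (H1 (maxn N1 N2)) ?leq_maxl // (H2 (maxn N1 N2)) ?leq_maxr //.
apply: eq_bigr => q _; apply: eq_bigr => p _; congr (tens _ _).
exact: vop_borcherds.
Qed.

End Pure.

Lemma tvop_borcherds : borcherds_identity tvop.
Proof.
move=> x y z l m n; rewrite -/(jac tvop x y z l m n).
elim/tens_ind: x => [|x x' Hx Hx'|f u].
- by apply: (jac0 tvop_bilinear); apply: Or31.
- exact: (jacDu tvop_bilinear).
elim/tens_ind: y => [|y y' Hy Hy'|g v].
- by apply: (jac0 tvop_bilinear); apply: Or32.
- exact: (jacDv tvop_bilinear).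
elim/tens_ind: z => [|z z' Hz Hz'|h w].
- by apply: (jac0 tvop_bilinear); apply: Or33.
- exact: (jacDw tvop_bilinear).
exact: tjac_pure.
Qed.

HB.instance Definition _ := isVertexAlgebra.Build K LV
  tvop_linearl tvop_linearr tvop_vacuuml tvop_vacuumr tvop_borcherds.

End TensorVertexAlgebra.

HB.instance Definition _ (K : pzRingType) (M : lmodType K) :=
  GRing.isLinear.Build K (laurent M) (laurent M) _ (@lderiv M)
    (fun c f g => etrans (lderivD (c *: f) g) (congr1 (+%R^~ (lderiv g)) (lderivZ c f))).

Section Derivations.
Variables (K : numFieldType) (W : vertexAlgType K).

Definition canonicalD (v : W) : W := modes vop v (- 2) vacuum.

Lemma canonicalD_is_linear : linear canonicalD.
Proof. exact/modes_linl/vop_bilinear. Qed.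
HB.instance Definition _ := GRing.isLinear.Build K W W _ canonicalD canonicalD_is_linear.

Definition derivation : set (W -> W) := [set d | linear d /\
  forall (u v : W) (n : int), d (vop u v n) = vop u (d v) n + vop (d u) v n].

End Derivations.

Section PseudoDerivations.
Variables (K : numFieldType) (V : vertexAlgType K).
Notation L := (laurent K^o).
Notation LV := (tensor L V).

Definition laurent_tensor : vertexAlgType K := LV.

Definition lact (f : L) : LV -> LV := tlift (fun g v => tens (f * g) v).

Definition Der_laurent : set (LV -> LV) := [set d |
  derivation d /\ forall (f : L) (x : LV), d (lact f x) = lact f (d x)].

(* Y(u,x), extended K((z))-linearly to K((z)) (x) V. *)
Definition vop_ext (u : V) : LV -> laurent LV :=
  tlift (fun g v => lmap (tens g) (vop u v)).

(* Y(.,x)v, extended K((z))[[x]]-linearly to K((z))[[x]] (x) V. *)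
Definition vop_series (X : tensor (nat -> L) V) (v : V) : laurent LV :=
  tlift (fun F u => ltens F (vop u v)) X.

(* If b is sum_i f_i(z) (x) u_i, this is sum_i f_i(z+x) (x) u_i. *)
Definition tshift : LV -> tensor (nat -> L) V := tmap (@taylor K) idfun.

Definition PDer : set (V -> LV) := [set a |
  [/\ linear a,
      forall v : V, tmap idfun (@canonicalD K V) (a v) - a (canonicalD v) =
                    - tmap (@lderiv K^o) idfun (a v)
    & forall (u v : V) (n : int),
        a (vop u v n) - vop_ext u (a v) n = vop_series (tshift (a u)) v n]].

Definition restriction (d : LV -> LV) : V -> LV := fun v => d (tens 1 v).

Definition extension (a : V -> LV) : LV -> LV := tlift (fun f v => lact f (a v)).

Lemma lact_bilinear f : is_bilinear (fun g v => tens (f * g) v : LV).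
Proof.
split=> [v c g h|g c v w]; last by rewrite tensDr tensZr.
by rewrite mulrDr -scalerAr tensDl tensZl.
Qed.
Lemma lact_tens f g v : lact f (tens g v) = tens (f * g) v.
Proof. exact/tlift_tens/lact_bilinear. Qed.
Lemma lact_linear f : linear (lact f).
Proof. exact/tlift_linear/lact_bilinear. Qed.
Lemma lact_linearl x : linear (lact^~ x).
Proof.
move=> c f g; rewrite /lact /tlift scaler_sumr -big_split; apply: eq_bigr => p _ /=.
by rewrite mulrDl -scalerAl tensDl tensZl.
Qed.

Lemma vop_ext_bilinear u :
  is_bilinear (fun g v => lmap (tens g) (vop u v) : laurent LV).
Proof.
split=> [v c g h|g c v w]; apply/laurentP => n; rewrite lcoefD lcoefZ !lmapE.
  by rewrite /= tensDl tensZl.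
by rewrite vop_linearr lcoefD lcoefZ /= tensDr tensZr.
Qed.
Lemma vop_ext_tens u g v : vop_ext u (tens g v) = lmap (tens g) (vop u v).
Proof. exact/tlift_tens/vop_ext_bilinear. Qed.

Lemma vop_series_bilinear v :
  is_bilinear (fun F u => ltens F (vop u v) : laurent LV).
Proof.
split=> [u c F G|F c u w]; first exact: ltens_linl.
by rewrite vop_linearl ltens_linr.
Qed.
Lemma vop_series_tens F u v : vop_series (tens F u) v = ltens F (vop u v).
Proof. exact/tlift_tens/vop_series_bilinear. Qed.

Lemma tshift_tens (f : L) (u : V) :
  tshift (tens f u) = @tens K (nat -> L) V (taylor f) u.
Proof. exact: tmap_tens. Qed.

Lemma extension_bilinear (a : V -> LV) : linear a -> is_bilinear (fun f v => lact f (a v)).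
Proof.
move=> la; split=> [v|f c v w]; first exact: lact_linearl.
by rewrite la lact_linear.
Qed.
Lemma extension_tens (a : V -> LV) f v : linear a -> extension a (tens f v) = lact f (a v).
Proof. by move=> la; apply/tlift_tens/extension_bilinear. Qed.

End PseudoDerivations.

Arguments Der_laurent {K} V.
Arguments PDer {K} V.

(* Main.v *)
From HB Require Import structures.
Require Import Defs.
From mathcomp Require Import all_boot all_order all_algebra.
From mathcomp Require Import all_classical reals complex.
From mathcomp Require Import zify.

Import GRing.Theory.
Local Open Scope classical_set_scope.
Local Open Scope ring_scope.
Local Open Scope complex_scope.

(** The restriction of a derivation [d] of [K((z)) (x) V] is a pseudoderivation
    because the two defining identities are instances of two facts about [d].
    A derivation kills the vacuum and so commutes with the canonical operator,
    which on the tensor product is [d/dz (x) 1 + 1 (x) D]; on [1 (x) V] the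
    first summand vanishes before [d] is applied and survives after, which
    produces the term [- d/dz a(z)] in the commutator with [D].  The
    commutator with [Y(u,x)] is the derivation rule on [1 (x) u] and
    [1 (x) v], since [Y^(1 (x) u, x)] is the [K((z))]-linear extension of
    [Y(u,x)] and [Y^(., x)(1 (x) v)] is [Y(a(z+x)u, x)v] on [a(z)u].

    Conversely, both terms of the derivation rule at [f (x) u] and [g (x) v]
    are [f(z+x) g(z)] times the corresponding terms at [1 (x) u] and
    [1 (x) v].  For the second one this is the multiplicativity
    [(f h)(z+x) = f(z+x) h(z+x)] of the Taylor expansion.  So the linear
    extension of a pseudoderivation satisfies the rule as soon as it does so on
    [1 (x) V].  The factor [f(z+x) g(z)] is a power series in [x] with
    coefficients in [K((z))]; its action on [(K((z)) (x) V)((x))] is [lser]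
    below, and the two factorizations are [tY_tens_lact] and [tY_lact_tens].

    What remains of the identification is that a [K((z))]-linear map is
    determined by its values on [1 (x) V]. *)

(** * Derivations and the canonical operator *)

Section DerivationFacts.
Context {K : numFieldType} {W : vertexAlgType K}.
Context {d : W -> W}.
Hypothesis d_der : derivation d.

Lemma derivation_vacuum : d vacuum = 0.
Proof.
have := d_der.2 vacuum vacuum 0; rewrite !vop_vacuuml /= vop_vacuumr //= => E.
by apply: (addrI (d vacuum)); rewrite addr0 -E.
Qed.

Lemma derivation_canonicalD v : d (canonicalD v) = canonicalD (d v).
Proof.
rewrite /canonicalD /modes d_der.2 derivation_vacuum.
by rewrite (bilinear0r (vop_bilinear W)) lcoef0 add0r.
Qed.

End DerivationFacts.

(** * The action of power series on Laurent series *)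

Section LaurentTensor.
Context {K : numFieldType} {V : vertexAlgType K}.
Notation L := (laurent K^o).
Notation LV := (tensor L V).

Lemma linear_morphD {M N : lmodType K} {g : M -> N} :
  linear g -> {morph g : x y / x + y}.
Proof. by move=> g_lin x y; rewrite -[x]scale1r g_lin !scale1r. Qed.

Lemma tens_additive_ext (M : zmodType) (g h : LV -> M) :
  {morph g : x y / x + y} -> {morph h : x y / x + y} ->
  (forall f v, g (tens f v) = h (tens f v)) -> g =1 h.
Proof.
move=> gD hD gh; elim/tens_ind => [|x y Hx Hy|f v]; last exact: gh.
  by rewrite -(tens0l L (0 : V)) gh.
by rewrite gD hD Hx Hy.
Qed.

Lemma lact_is_bilinear : is_bilinear (@lact K V).
Proof. by split; [exact: lact_linearl | exact: lact_linear]. Qed.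

Lemma lactA f g (x : LV) : lact f (lact g x) = lact (f * g) x.
Proof.
elim/tens_ind: x => [|x y Hx Hy|h v].
- by rewrite !(bilinear0r lact_is_bilinear).
- by rewrite !(bilinearDr lact_is_bilinear) Hx Hy.
- by rewrite !lact_tens mulrA.
Qed.

Lemma lact1 (x : LV) : lact 1 x = x.
Proof.
move: x; apply: tens_additive_ext => // [x y|f v].
  exact: bilinearDr lact_is_bilinear _ _ _.
by rewrite lact_tens mul1r.
Qed.

Definition ltmul : tensor L LV -> LV := tlift (@lact K V).

Lemma ltmul_linear : linear ltmul.
Proof. exact/tlift_linear/lact_is_bilinear. Qed.
HB.instance Definition _ :=
  GRing.isLinear.Build K (tensor L LV) LV _ ltmul ltmul_linear.

Lemma ltmul_tens f x : ltmul (tens f x) = lact f x.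
Proof. exact/tlift_tens/lact_is_bilinear. Qed.

(** The product of a series in [K((z))[[x]]] with a series in
    [(K((z)) (x) V)((x))].  Going through [ltens] makes its linearity and the
    finiteness of the coefficient sums come for free. *)
Definition lser (F : nat -> L) (w : laurent LV) : laurent LV :=
  lmap ltmul (ltens F w).

Lemma lserD F v w : lser F (v + w) = lser F v + lser F w.
Proof.
apply/laurentP => n; rewrite lcoefD !lmapE.
by rewrite (bilinearDr (ltens_bilinear L LV)) lcoefD raddfD.
Qed.

Lemma lserE F (w : laurent LV) (n : int) N :
  (forall k, (N <= k)%N -> w (n - k%:Z) = 0) ->
  lser F w n = \sum_(k < N) lact (F k) (w (n - k%:Z)).
Proof.
move=> H; rewrite lmapE (ltensE _ H) raddf_sum.
by apply: eq_bigr => k _; exact: ltmul_tens.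
Qed.

(** [taylor 1] is the constant series [1]; the trailing factor gives the left
    side the form of the series in [tY_tens_lact] and [tY_lact_tens], whose
    case [f = g = 1] is then [tY_1tens] and [tY_tens1]. *)
Lemma lser1 (w : laurent LV) : lser (fun k => taylor 1 k * 1) w = w.
Proof.
apply/laurentP => n; have [N HN] := lbound_nat w n.
rewrite (@lserE _ _ _ N.+1) => [|k Hk]; last by apply: HN; lia.
rewrite big_ord_recl big1 => [|k _].
  by rewrite addr0 taylor0 mulr1 lact1 subr0.
by rewrite taylor_1 mul0r (bilinear0l lact_is_bilinear).
Qed.

Lemma lser_lmap F h (w : laurent V) :
  lser F (lmap (tens h) w) = ltens (fun k => F k * h) w.
Proof.
apply/laurentP => n; have [N HN] := lbound_nat w n.
rewrite (ltensE _ HN) (@lserE _ _ _ N); last first.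
  by move=> k /HN E; rewrite lmapE E raddf0.
by apply: eq_bigr => k _; rewrite lmapE lact_tens.
Qed.

(** Associativity of the action: [F(x) (G(x) (x) w(x)) = F(x) G(x) (x) w(x)],
    with the Cauchy product [F(x) G(x)]. *)
Lemma lser_ltens (F G : nat -> L) (w : laurent V) :
  lser F (ltens G w) = ltens (fun p => \sum_(i < p.+1) F i * G (p - i)%N) w.
Proof.
apply/laurentP => n; have [N HN] := lbound_nat w n.
(* The coefficients of index [n - k] are all expanded up to the same [N], so
   that the sum over the square [N x N] can be regrouped along antidiagonals. *)
have HG k j : (N <= k + j)%N -> w (n - k%:Z - j%:Z) = 0.
  by move=> /HN <-; congr (lcoef _ _); lia.
rewrite (ltensE _ HN) (@lserE _ _ _ N) => [|k Hk]; last first.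
  by rewrite (@ltensE _ _ _ _ _ _ 0) ?big_ord0 // => j _; apply: HG; lia.
pose T i j : LV := tens (F i * G j) (w (n - i%:Z - j%:Z)).
transitivity (\sum_(i < N) \sum_(j < N) T i j).
  apply: eq_bigr => k _; rewrite (@ltensE _ _ _ _ _ _ N) => [|j Hj]; last first.
    by apply: HG; lia.
  rewrite -(ltmul_tens (F k)) !raddf_sum; apply: eq_bigr => j _.
  by rewrite /= ltmul_tens lact_tens.
rewrite -(@sum_triangle _ N T) => [|a p Hap]; last by rewrite /T HG ?tens0r.
apply: eq_bigr => p _; rewrite tens_suml; apply: eq_bigr => i _.
by rewrite /T; congr (tens _ (lcoef _ _)); have := ltn_ord i; lia.
Qed.

(** * Vertex operators of the tensor product *)

Notation tY := (@vop K (laurent_tensor V)).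

Lemma tY_tens f u g v :
  tY (tens f u) (tens g v) = ltens (fun k => taylor f k * g) (vop u v).
Proof. exact: tvop_tens. Qed.

Lemma lderiv1 : lderiv (1 : L) = 0.
Proof. by have := lderiv_taylor (1 : L) 0; rewrite taylor0 taylor_1 scaler0. Qed.

(** The vacuum pairing with [f (x) u] is [f(z+x) (x) Y(u,x)1], whose
    [x]-linear term collects [f'(z) (x) u] and [f(z) (x) D u]. *)
Lemma canonicalD_tensor (x : LV) :
  canonicalD (x : laurent_tensor V) =
  tmap (@lderiv K^o) idfun x + tmap idfun (@canonicalD K V) x.
Proof.
elim/tens_ind: x => [|x y Hx Hy|f u]; first by rewrite !raddf0 addr0.
  by rewrite !raddfD /= Hx Hy addrACA.
rewrite !tmap_tens /canonicalD /modes.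
rewrite [vop _ _ _](congr1 (fun w => lcoef w _) (tY_tens f u 1 vacuum)).
rewrite (@ltensE _ _ _ _ _ _ 2); last first.
  by move=> k Hk; rewrite vop_vacuumr ?ifF //; lia.
rewrite big_ord_recl big_ord1 /= !mulr1 taylor0 addrC; congr (_ + _).
by rewrite vop_vacuumr //= /taylor /= invr1 scale1r.
Qed.

Lemma vop_extD u : {morph (@vop_ext K V u) : x y / x + y}.
Proof. exact: linear_morphD (tlift_linear (vop_ext_bilinear u)). Qed.

Lemma vop_series_tshiftD v :
  {morph (fun x : LV => vop_series (tshift x) v) : x y / x + y}.
Proof.
move=> x y; rewrite /tshift raddfD.
exact: linear_morphD (tlift_linear (vop_series_bilinear v)) _ _.
Qed.

Lemma extensionD {a : V -> LV} :
  linear a -> {morph (extension a : LV -> LV) : x y / x + y}.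
Proof. by move=> a_lin; apply: linear_morphD (tlift_linear (extension_bilinear a_lin)). Qed.

Lemma tY_tens_lact f u g (y : LV) :
  tY (tens f u) (lact g y) = lser (fun k => taylor f k * g) (vop_ext u y).
Proof.
move: y; apply: tens_additive_ext => [x y|x y|h v].
- by rewrite (bilinearDr lact_is_bilinear) (bilinearDr (vop_bilinear _)).
- by rewrite vop_extD lserD.
rewrite lact_tens tY_tens vop_ext_tens lser_lmap.
by congr (ltens _ _); apply/funext => k; rewrite mulrA.
Qed.

(** Multiplicativity of the Taylor expansion: [f(z+x)] comes out of
    [(f h)(z+x)] for every term [h (x) u] of the tensor. *)
Lemma tY_lact_tens f (x : LV) g v :
  tY (lact f x) (tens g v) =
  lser (fun k => taylor f k * g) (vop_series (tshift x) v).
Proof.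
move: x; apply: tens_additive_ext => [x y|x y|h u].
- by rewrite (bilinearDr lact_is_bilinear) (bilinearDl (vop_bilinear _)).
- by rewrite vop_series_tshiftD lserD.
rewrite lact_tens tY_tens tshift_tens vop_series_tens lser_ltens.
congr (ltens _ _); apply/funext => k; rewrite taylorM mulr_suml.
by apply: eq_bigr => i _; rewrite mulrAC.
Qed.

Lemma tY_1tens u (y : LV) : tY (tens 1 u) y = vop_ext u y.
Proof. by rewrite -{1}(lact1 y) tY_tens_lact lser1. Qed.

Lemma tY_tens1 (x : LV) v : tY x (tens 1 v) = vop_series (tshift x) v.
Proof. by rewrite -{1}(lact1 x) tY_lact_tens lser1. Qed.

(** * Restriction and extension *)

Lemma PDer_restriction {d : LV -> LV} :
  @derivation K (laurent_tensor V) d -> PDer V (restriction d).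
Proof.
move=> d_der; split=> [c u v|v|u v n].
- by rewrite /restriction tensDr tensZr d_der.1.
- have := derivation_canonicalD d_der (tens 1 v).
  rewrite !canonicalD_tensor !tmap_tens /= lderiv1 tens0l add0r /restriction => ->.
  by rewrite opprD addrCA subrr addr0.
- have := d_der.2 (tens 1 u) (tens 1 v) n.
  rewrite !tY_1tens tY_tens1 vop_ext_tens lmapE /restriction => ->.
  by rewrite addrC addKr.
Qed.

(** A [K((z))]-linear map commutes with multiplication by a series [F(x)], so
    the extension of [a] is computed on [F(x) (x) w(x)] by applying [a] to the
    coefficients of [w].  The series [aw] of these values is supplied by the
    caller because a bare linear [a] does not come with the structure that
    [lmap] asks for. *)
Lemma extension_ltens (a : V -> LV) F (w : laurent V) (aw : laurent LV) n :
  linear a -> (forall m, aw m = a (w m)) ->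
  extension a (ltens F w n) = lser F aw n.
Proof.
move=> a_lin aw_w; have [N HN] := lbound_nat w n.
have a0 : a 0 = 0 by apply: (addrI (a 0)); rewrite -(linear_morphD a_lin) !addr0.
rewrite (ltensE _ HN) (@lserE _ _ _ N) => [|k /HN E]; last by rewrite aw_w E.
pose ext : {additive LV -> LV} := HB.pack (extension a)
  (GRing.isLinear.Build _ _ _ _ _ (tlift_linear (extension_bilinear a_lin))).
rewrite -[extension a]/(ext : LV -> LV) raddf_sum; apply: eq_bigr => k _.
by rewrite /ext /= extension_tens // aw_w.
Qed.

Lemma derivation_extension (a : V -> LV) :
  PDer V a -> @derivation K (laurent_tensor V) (extension a).
Proof.
move=> [a_lin _ aY]; have extD := extensionD a_lin.
split=> [|x y n]; first exact/tlift_linear/extension_bilinear.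
move: x.
apply: tens_additive_ext => [x x'|x x'|f u].
- by rewrite (bilinearDl (vop_bilinear _)) lcoefD extD.
- by rewrite extD !(bilinearDl (vop_bilinear _)) !lcoefD addrACA.
move: y; apply: tens_additive_ext => [y y'|y y'|g v].
- by rewrite (bilinearDr (vop_bilinear _)) lcoefD extD.
- by rewrite extD !(bilinearDr (vop_bilinear _)) !lcoefD addrACA.
rewrite !extension_tens // tY_tens_lact tY_lact_tens tY_tens -lcoefD -lserD.
by apply: extension_ltens => // m; rewrite lcoefD -aY subrKC.
Qed.

Lemma Der_laurent_extension (a : V -> LV) :
  PDer V a -> Der_laurent V (extension a).
Proof.
move=> aP; have [a_lin _ _] := aP.
have extD := extensionD a_lin.
split=> [|f]; first exact: derivation_extension.
apply: tens_additive_ext => [x y|x y|g v].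
- by rewrite (bilinearDr lact_is_bilinear) extD.
- by rewrite -(bilinearDr lact_is_bilinear) -extD.
by rewrite lact_tens !extension_tens // lactA.
Qed.

Lemma restrictionK (d : LV -> LV) :
  Der_laurent V d -> extension (restriction d) = d.
Proof.
move=> [d_der d_lact]; have [r_lin _ _] := PDer_restriction d_der.
apply/funext; apply: tens_additive_ext => [||f v].
- exact: extensionD.
- exact: linear_morphD d_der.1.
by rewrite extension_tens // -d_lact lact_tens mulr1.
Qed.

Lemma extensionK (a : V -> LV) : linear a -> restriction (extension a) = a.
Proof.
by move=> a_lin; apply/funext => v; rewrite /restriction extension_tens // lact1.
Qed.

End LaurentTensor.

Theorem proposition2p5 (R : realType) (V : vertexAlgType R[i]) :
  [/\ forall d : laurent_tensor V -> laurent_tensor V,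
        derivation d -> PDer V (restriction d),
      forall a : V -> laurent_tensor V,
        PDer V a -> derivation (extension a : laurent_tensor V -> laurent_tensor V)
    & [/\ [set restriction d | d in Der_laurent V] = PDer V,
          [set extension a | a in PDer V] = Der_laurent V,
          forall d, Der_laurent V d -> extension (restriction d) = d
        & forall a, PDer V a -> restriction (extension a) = a]].
Proof.
split; [by move=> d; exact: PDer_restriction | exact: derivation_extension | split].
- apply/seteqP; split=> [_ [d [d_der _] <-]|a aP]; first exact: PDer_restriction.
  exists (extension a); first exact: Der_laurent_extension.
  by apply: extensionK; case: aP.
- apply/seteqP; split=> [_ [a aP <-]|d dP]; first exact: Der_laurent_extension.
  by exists (restriction d); [exact: (PDer_restriction dP.1) | exact: restrictionK].
- exact: restrictionK.
- by move=> a [a_lin _ _]; exact: extensionK.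
Qed.
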